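(* Let $m>n$. The minimum size of a treelike Resolution refutation of $\mathrm{BinPHP}^m_n$ is $2^{\Theta(n)}$.
   Context: $n$ is a power of 2; for a hole $a\in[n]$, $a_1\dots a_{\log n}$ is its binary representation; $\omega^1=\omega$, $\omega^0=\neg\omega$. $\mathrm{BinPHP}^m_n$ has variables $\omega_{i,\ell}$ ($i\in[m]$ pigeons, $\ell\in[\log n]$) and, for all $i\neq i'\in[m]$, $a\in[n]$, the clause $\bigvee_{\ell}\omega_{i,\ell}^{1-a_\ell}\vee\bigvee_\ell\omega_{i',\ell}^{1-a_\ell}$. A treelike Resolution refutation is a Resolution refutation whose underlying derivation graph is a tree (each derived clause is used at most once); size is the number of inference steps. *)

(* Defs.v *)
From HB Require Import structures.
From mathcomp Require Import all_boot.

Set Implicit Arguments.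
Unset Strict Implicit.
Unset Printing Implicit Defensive.

Section Resolution.
Variable V : finType.

(* (x, b) is the literal x^b: x if b = true, the negation of x if b = false. *)
Definition literal : Type := (V * bool)%type.

Definition clause : Type := {set literal}.

Definition resolvent (x : V) (C D : clause) : clause :=
  (C :\ (x, true)) :|: (D :\ (x, false)).

(* Derivations are trees, so an occurrence of a derived clause is the premise
   of at most one inference; clauses of F may label any number of leaves. *)
Inductive treelike (F : {set clause}) : clause -> Type :=
| Initial (C : clause) of C \in F : treelike F C
| Resolve (x : V) (C D : clause) of (x, true) \in C & (x, false) \in D
    & treelike F C & treelike F D : treelike F (resolvent x C D).

Definition treelike_refutation (F : {set clause}) : Type := treelike F set0.

(* Leaves are not inferences and are not counted. *)
Fixpoint treelike_size (F : {set clause}) (C : clause) (p : treelike F C)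
    {struct p} : nat :=
  match p with
  | Initial _ _ => 0
  | Resolve _ _ _ _ _ p1 p2 => (treelike_size p1 + treelike_size p2).+1
  end.

Definition is_min_treelike_size (F : {set clause}) (s : nat) : Prop :=
  (exists p : treelike_refutation F, treelike_size p = s) /\
  (forall p : treelike_refutation F, s <= treelike_size p).

End Resolution.

(* Exact logarithm when n is a power of 2, the only case of interest. *)
Definition log2 (n : nat) : nat := trunc_log 2 n.

(* The most significant bit has index 0; 'I_n stands for the n holes. *)
Definition hole_bit (n : nat) (a : 'I_n) (l : 'I_(log2 n)) : bool :=
  odd (a %/ 2 ^ (log2 n - l.+1)).

Definition binphp_var (m n : nat) : finType := ('I_m * 'I_(log2 n))%type.

Definition binphp_clause (m n : nat) (i i' : 'I_m) (a : 'I_n) :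
    clause (binphp_var m n) :=
  [set ((i, l), ~~ hole_bit a l) | l : 'I_(log2 n)] :|:
  [set ((i', l), ~~ hole_bit a l) | l : 'I_(log2 n)].

Definition BinPHP (m n : nat) : {set clause (binphp_var m n)} :=
  [set C | [exists i : 'I_m, exists i' : 'I_m, exists a : 'I_n,
              (i != i') && (C == binphp_clause i i' a)]].

(* Main.v *)
Require Import Defs.
From HB Require Import structures.
From mathcomp Require Import all_boot all_order all_algebra.
From mathcomp Require Import boolp reals exp zify.
Import Order.TTheory GRing.Theory Num.Theory.

(** Lower bound: walk from the root of a refutation to its leaves along a
    partial injection of pigeons into holes that falsifies the current clause.
    When a variable of an unplaced pigeon is resolved and fewer than [n / 2]
    holes are occupied, both values of the bit extend to a free hole, so the
    walk branches; no leaf is reached this way, hence there are at least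
    [2 ^ (n / 2)] leaves.

    Upper bound: given more than [2 ^ r] pigeons known to agree on all but the
    last [r] bits, query the next bit of [2 ^ r + 1] of them and recurse on a
    majority value.  The depth of this decision tree is
    [\sum_(1 <= r <= log n) (2 ^ r + 1) = O(n)]. *)

Set Implicit Arguments.
Unset Strict Implicit.
Unset Printing Implicit Defensive.

(** * Holes as bit strings *)

Lemma binary_digits_inj k a b :
  a < 2 ^ k -> b < 2 ^ k ->
  (forall j, j < k -> odd (a %/ 2 ^ j) = odd (b %/ 2 ^ j)) -> a = b.
Proof.
elim: k a b => [|k IHk] a b; first by rewrite expn0; lia.
rewrite expnS => lt_a lt_b eq_ab.
have eq_half : a %/ 2 = b %/ 2.
  apply: IHk => [||j lt_jk]; rewrite ?ltn_divLR ?(mulnC (2 ^ k)) //.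
  by rewrite -!divnMA -expnS; apply: eq_ab.
have := eq_ab 0 isT; rewrite expn0 !divn1 => eq_odd.
by rewrite -(odd_double_half a) -(odd_double_half b) -!divn2 eq_odd eq_half.
Qed.

Section Holes.
Variable n : nat.
Hypothesis pow_n : 2 ^ log2 n = n.

Definition hole_bits (a : 'I_n) : {ffun 'I_(log2 n) -> bool} :=
  [ffun l => hole_bit a l].

Lemma hole_bits_inj : injective hole_bits.
Proof.
move=> a b /ffunP eq_ab; apply/val_inj/(@binary_digits_inj (log2 n)).
- by rewrite pow_n ltn_ord.
- by rewrite pow_n ltn_ord.
move=> j lt_j.
have lt_l : log2 n - j.+1 < log2 n by lia.
have := eq_ab (Ordinal lt_l); rewrite !ffunE /hole_bit /=.
by have -> : log2 n - (log2 n - j.+1).+1 = j by lia.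
Qed.

Lemma hole_bits_bij : bijective hole_bits.
Proof.
apply: (inj_card_bij hole_bits_inj).
by rewrite card_ffun card_bool !card_ord pow_n.
Qed.

Lemma hole_of_bits (f : 'I_(log2 n) -> bool) :
  exists a : 'I_n, forall l, hole_bit a l = f l.
Proof.
have [g _ gK] := hole_bits_bij; exists (g [ffun l => f l]) => l.
by have /ffunP/(_ l) := gK [ffun l => f l]; rewrite !ffunE.
Qed.

(** Flipping bit [l] is an involution on holes that exchanges the two values of that bit. If [U]
    contained every hole with value [b], then [U] and its flipped image would cover all [n]
    holes. *)
Lemma free_hole (U : {set 'I_n}) (l : 'I_(log2 n)) (b : bool) :
  #|U|.*2 < n -> exists2 a, a \notin U & hole_bit a l = b.
Proof.
move=> U_small.
case: (pickP [pred a | (a \notin U) && (hole_bit a l == b)]) => [a|no_a].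
  by case/andP=> ? /eqP; exists a.
have inU a : hole_bit a l = b -> a \in U.
  by move=> ab; have := no_a a; rewrite /= ab eqxx andbT => /negbFE.
have [g bK gK] := hole_bits_bij.
pose flip a := g [ffun l' => hole_bit a l' (+) (l' == l)].
have flip_bit a l' : hole_bit (flip a) l' = hole_bit a l' (+) (l' == l).
  have /ffunP/(_ l') := gK [ffun l' => hole_bit a l' (+) (l' == l)].
  by rewrite !ffunE.
have flipK : involutive flip.
  by move=> a; apply/hole_bits_inj/ffunP=> l'; rewrite !ffunE !flip_bit addbK.
have cover : [set: 'I_n] \subset U :|: flip @: U.
  apply/subsetP=> a _; rewrite inE.
  have [/eqP/inU -> //|ab] := boolP (hole_bit a l == b).
  rewrite -[a in a \in flip @: _]flipK imset_f ?orbT // inU //.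
  by rewrite flip_bit eqxx; move: ab; case: hole_bit; case: (b).
have := leq_trans (subset_leq_card cover) (leq_card_setU _ _).
rewrite cardsT card_ord (card_imset _ (inv_inj flipK)) addnn.
by rewrite leqNgt U_small.
Qed.

End Holes.

(** * Lower bound by counting leaves *)

Section LowerBound.
Variables m n : nat.
Hypotheses (pow_n : 2 ^ log2 n = n) (log_n_gt0 : 0 < log2 n).

Definition falsified (rho : 'I_m -> option 'I_n)
    (x : literal (binphp_var m n)) : Prop :=
  exists2 a, rho x.1.1 = Some a & hole_bit a x.1.2 = ~~ x.2.

(** [(treelike_size p).+1] is the number of leaves of [p], which adds up over the two premises of an
    inference. Each branching occupies one more hole, so [n./2 - #|U|] branchings are still
    guaranteed. *)
Lemma treelike_size_lower (C : clause (binphp_var m n))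
    (p : treelike (BinPHP m n) C) (rho : 'I_m -> option 'I_n) (U : {set 'I_n}) :
  (forall i a, rho i = Some a -> a \in U) ->
  (forall i i' a, rho i = Some a -> rho i' = Some a -> i = i') ->
  (forall x, x \in C -> falsified rho x) ->
  2 ^ (n./2 - #|U|) <= (treelike_size p).+1.
Proof.
elim: {C} p rho U => [C CF|[i l] C D xC xD p IHp q IHq] rho U rhoU rho_inj rhoC /=.
  move: CF; rewrite inE => /existsP[i /existsP[i' /existsP[a /andP[neq_i /eqP defC]]]].
  (* Falsifying every literal of pigeon [j] forces its hole to have the bits of [a]; both pigeons of
     an initial clause would then share [a]. *)
  suff rho_a j : (forall l, ((j, l), ~~ hole_bit a l) \in C) -> rho j = Some a.
    case/eqP: neq_i; apply: (rho_inj _ _ a); apply: rho_a => l;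
    by rewrite defC inE imset_f ?orbT.
  move=> jC; have [a' /= rho_j _] := rhoC _ (jC (Ordinal log_n_gt0)).
  rewrite rho_j; congr Some; apply: (hole_bits_inj pow_n); apply/ffunP=> l.
  rewrite !ffunE; have [a'' /=] := rhoC _ (jC l).
  by rewrite rho_j negbK => -[->].
have step rho' :
    (forall x, falsified rho x -> falsified rho' x) ->
    (falsified rho' ((i, l), true) -> forall x, x \in C -> falsified rho' x)
    /\ (falsified rho' ((i, l), false) -> forall x, x \in D -> falsified rho' x).
  move=> ext; split=> fx y yC.
    have [->//|neq_y] := eqVneq y ((i, l), true).
    by apply/ext/rhoC; rewrite !inE neq_y yC.
  have [->//|neq_y] := eqVneq y ((i, l), false).
  by apply/ext/rhoC; rewrite !inE neq_y yC orbT.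
(* If pigeon [i] is placed, its hole already falsifies the pivot literal of one premise, and the
   walk goes there without branching. *)
case rho_i: (rho i) => [a|].
  have [stepC stepD] := step rho (fun _ => id).
  case ab: (hole_bit a l).
    apply: leq_trans (IHq rho U rhoU rho_inj (stepD _)) _; first by exists a.
    by rewrite ltnS leqW ?leq_addl.
  apply: leq_trans (IHp rho U rhoU rho_inj (stepC _)) _; first by exists a.
  by rewrite ltnS leqW ?leq_addr.
have [U_big|U_small] := leqP n./2 #|U|.
  by have -> : n./2 - #|U| = 0 by lia.
have extend b : exists rho' (U' : {set 'I_n}),
    [/\ #|U'| = #|U|.+1, forall j a, rho' j = Some a -> a \in U',
        forall j j' a, rho' j = Some a -> rho' j' = Some a -> j = j',
        forall x, falsified rho x -> falsified rho' x &
        falsified rho' ((i, l), ~~ b)].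
  have [|a aU ab] := @free_hole n pow_n U l b; first by lia.
  exists (fun j => if j == i then Some a else rho j), (a |: U); split.
  - by rewrite cardsU1 aU.
  - move=> j a'; case: eqP => _; first by case=> <-; rewrite setU11.
    by move/rhoU=> a'U; rewrite inE a'U orbT.
  - move=> j j' a'; case: eqP => [->|_]; case: eqP => [->|_] //.
    + by case=> <- /rhoU; rewrite (negbTE aU).
    + by move=> /rhoU a'U [def_a]; rewrite def_a a'U in aU.
    + exact: rho_inj.
  - move=> x [a' rho_x xa']; exists a' => //.
    by case: eqP => // eq_i; rewrite eq_i rho_i in rho_x.
  - by exists a; rewrite /= ?eqxx ?negbK.
have [rho0 [U0 [cU0 rhoU0 inj0 ext0 fals0]]] := extend false.
have [rho1 [U1 [cU1 rhoU1 inj1 ext1 fals1]]] := extend true.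
have := IHp _ _ rhoU0 inj0 ((step _ ext0).1 fals0).
have := IHq _ _ rhoU1 inj1 ((step _ ext1).2 fals1).
have -> : n./2 - #|U| = (n./2 - #|U|.+1).+1 by lia.
rewrite cU0 cU1 expnS mul2n -addnn => le_q le_p.
by apply: leq_trans (leq_add le_p le_q) _; rewrite addSn addnS.
Qed.

Lemma refutation_size_lower (p : treelike_refutation (BinPHP m n)) :
  2 ^ n./2 <= (treelike_size p).+1.
Proof.
have := @treelike_size_lower _ p (fun _ => None) set0.
by rewrite cards0 subn0; apply=> // x; rewrite inE.
Qed.

End LowerBound.

(** * From decision trees to treelike derivations *)

Section DecisionTree.
Variables (V : finType) (F : {set clause V}).

(* [A] is the set of literals falsified by the answers given so far, and [N]
   bounds the number of leaves of the remaining decision tree. *)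
Definition derivable_within (A : clause V) (N : nat) : Prop :=
  exists C : clause V, C \subset A /\ exists p : treelike F C, treelike_size p < N.

Lemma derivable_withinW (A B : clause V) (M N : nat) :
  A \subset B -> M <= N -> derivable_within A M -> derivable_within B N.
Proof.
move=> sAB leMN [C [sCA [p sz_p]]]; exists C; split; first exact: subset_trans sAB.
by exists p; apply: leq_trans leMN.
Qed.

Lemma derivable_query (x : V) (A : clause V) (M N : nat) :
  derivable_within ((x, true) |: A) M -> derivable_within ((x, false) |: A) N ->
  derivable_within A (M + N).
Proof.
move=> [C [sC [p sz_p]]] [D [sD [q sz_q]]].
(* If the clause of a branch lacks its pivot literal, it already lies within [A] and serves without
   an inference. *)
have [xC|xC] := boolP ((x, true) \in C); last first.
  exists C; split; last by exists p; lia.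
  apply/subsetP=> y yC; have := subsetP sC y yC.
  by rewrite !inE => /orP[/eqP ey|//]; rewrite -ey yC in xC.
have [xD|xD] := boolP ((x, false) \in D); last first.
  exists D; split; last by exists q; lia.
  apply/subsetP=> y yD; have := subsetP sD y yD.
  by rewrite !inE => /orP[/eqP ey|//]; rewrite -ey yD in xD.
exists (resolvent x C D); split; last by exists (Resolve xC xD p q) => /=; lia.
by rewrite subUset !subDset sC sD.
Qed.

Lemma derivable_query_seq (s : seq V) (A : clause V) (N : nat) :
  uniq s ->
  (forall b : V -> bool,
     derivable_within (A :|: [set (x, b x) | x in s]) N) ->
  derivable_within A (2 ^ size s * N).
Proof.
elim: s A => [|x s IHs] A /= => [_ /(_ predT)|/andP[xs uniq_s] derA].
  apply: derivable_withinW; last by rewrite mul1n.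
  by apply/subsetP=> y; rewrite inE => /orP[//|/imsetP[]].
rewrite expnS -mulnA mul2n -addnn.
suff branch c : derivable_within ((x, c) |: A) (2 ^ size s * N).
  exact: derivable_query.
apply: IHs => // b.
(* Overriding [b] at [x] leaves the answers on [s] unchanged, because [x] does not occur in [s]. *)
apply: derivable_withinW (derA (fun y => if y == x then c else b y)) => //.
apply/subsetP=> y; rewrite !inE => /orP[->|]; first by rewrite !orbT.
case/imsetP=> z; rewrite inE => /orP[/eqP->|zs] ->; first by rewrite !eqxx.
have /negbTE -> : z != x by apply: contraNneq xs => <-.
by rewrite imset_f ?orbT.
Qed.

End DecisionTree.

(** * Upper bound by majority queries *)

Section UpperBound.
Variables m n : nat.
Hypothesis pow_n : 2 ^ log2 n = n.

Lemma majority (T : finType) (S : {set T}) (b : T -> bool) (k : nat) :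
  k.*2 < #|S| -> exists c, k < #|[set x in S | b x == c]|.
Proof.
move=> ltS; case: (ltnP k #|[set x in S | b x == true]|) => [|le1]; first by exists true.
exists false; rewrite ltnNge; apply/negP => le0.
have : S \subset [set x in S | b x == true] :|: [set x in S | b x == false].
  by apply/subsetP=> x xS; rewrite !inE xS; case: (b x).
move/subset_leq_card/leq_trans/(_ (leq_card_setU _ _)); lia.
Qed.

(** The exponent e(r) = 3 * 2 ^ r - 2 satisfies e(0) = 1 and e(r) + 2 ^ (r + 1) + 1 <= e(r + 1),
    where 2 ^ (r + 1) + 1 is the number of queries at level r + 1. The condition [l + r < log2 n]
    selects all but the last [r] bits. *)
Lemma binphp_derivable r (A : clause (binphp_var m n)) (S : {set 'I_m})
    (f : 'I_(log2 n) -> bool) :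
  r <= log2 n -> 2 ^ r < #|S| ->
  (forall i (l : 'I_(log2 n)), i \in S -> l + r < log2 n -> ((i, l), ~~ f l) \in A) ->
  derivable_within (BinPHP m n) A (2 ^ (3 * 2 ^ r - 2)).
Proof.
elim: r A S f => [|r IHr] A S f le_r ltS SA.
  have /card_gt1P[i [i' [iS i'S neq_i]]] : 1 < #|S| by [].
  have [a ab] := hole_of_bits pow_n f.
  have aF : binphp_clause i i' a \in BinPHP m n.
    rewrite inE; apply/existsP; exists i; apply/existsP; exists i'.
    by apply/existsP; exists a; rewrite neq_i eqxx.
  exists (binphp_clause i i' a); split; last by exists (Initial aF) => /=.
  apply/subsetP=> y; rewrite inE => /orP[] /imsetP[l _ ->]; rewrite ab;
  by apply: SA; rewrite // addn0.
have lt_l : log2 n - r.+1 < log2 n by lia.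
(* [l0] is the first bit on which agreement is not yet known. Among 2 ^ (r + 1) + 1 pigeons, some
   value of it is shared by more than 2 ^ r. *)
pose l0 := Ordinal lt_l.
pose s := [seq (i, l0) | i <- take (2 ^ r.+1).+1 (enum S)].
have sz_s : size s = (2 ^ r.+1).+1.
  by rewrite size_map size_takel // -cardE.
have uniq_s : uniq s.
  by rewrite map_inj_uniq ?take_uniq ?enum_uniq // => i j [].
apply: (@derivable_withinW _ _ A A (2 ^ size s * 2 ^ (3 * 2 ^ r - 2))) => //.
  rewrite sz_s -expnD leq_exp2l //.
  by have := expn_gt0 2 r; rewrite expnS; lia.
apply: derivable_query_seq => // b.
pose S' := [set i in take (2 ^ r.+1).+1 (enum S)].
have cS' : #|S'| = (2 ^ r.+1).+1.
  rewrite cardsE (card_uniqP _) ?take_uniq ?enum_uniq //.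
  by rewrite size_takel // -cardE.
(* [b] gives the sign of the falsified literal, so the value of the bit is its negation. *)
have [|c ltS''] := @majority _ S' (fun i => ~~ b (i, l0)) (2 ^ r).
  by rewrite cS' expnS mul2n.
apply: (IHr _ _ (fun l => if l == l0 then c else f l) _ ltS''); first by lia.
move=> i l; rewrite !inE => /andP[iS' /eqP bi] lt_lr.
case: eqP => [->|/eqP neq_l].
  by rewrite -bi negbK (imset_f (fun x => (x, b x))) ?orbT //; apply: map_f.
rewrite SA //; first by rewrite -mem_enum (mem_take iS').
suff : (l : nat) != log2 n - r.+1 by lia.
exact: neq_l.
Qed.

Lemma refutation_size_upper : n < m ->
  exists p : treelike_refutation (BinPHP m n), treelike_size p < 2 ^ (3 * n).
Proof.
move=> lt_nm.
have [||C [C0 [p sz_p]]] :=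
  @binphp_derivable (log2 n) set0 [set: 'I_m] (fun _ => true) (leqnn _).
- by rewrite pow_n cardsT card_ord.
- by move=> i l _; lia.
move: p sz_p; move: C0; rewrite subset0 => /eqP -> p; rewrite pow_n => sz_p.
by exists p; apply: leq_trans sz_p _; rewrite leq_exp2l // leq_subr.
Qed.

End UpperBound.

Lemma min_treelike_size_exists (V : finType) (F : {set clause V}) :
  treelike_refutation F -> exists s, is_min_treelike_size F s.
Proof.
move=> p; pose P s := `[< exists q : treelike_refutation F, treelike_size q = s >].
have exP : exists s, P s by exists (treelike_size p); apply/asboolP; exists p.
exists (ex_minn exP); case: ex_minnP => s /asboolP Ps min_s; split=> // q.
by apply: min_s; apply/asboolP; exists q.
Qed.

Local Open Scope ring_scope.

Theorem theorem4p9 (R : realType) :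
  exists c1 c2 : R, [/\ 0 < c1, 0 < c2 &
    exists n0 : nat, forall n m : nat,
      (n0 <= n)%N -> (exists k : nat, n = (2 ^ k)%N) -> (n < m)%N ->
      exists s : nat, is_min_treelike_size (BinPHP m n) s /\
        powR 2 (c1 * n%:R) <= s%:R <= powR 2 (c2 * n%:R)].
Proof.
(* Weakening 2 ^ (n / 2) - 1 to 2 ^ (n / 4) absorbs the subtracted 1, and a power of 2 that is at
   least 4 is divisible by 4. *)
exists 4^-1, 3; split; [by rewrite invr_gt0 ltr0n | by rewrite ltr0n | ].
exists 4%N => n m le4n [k def_n] lt_nm.
have log_n : log2 n = k by rewrite /log2 def_n trunc_expnK.
have pow_n : (2 ^ log2 n)%N = n by rewrite log_n.
have le2k : (2 <= k)%N by rewrite -(leq_exp2l (m := 2)) // -def_n.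
have log_gt0 : (0 < log2 n)%N by rewrite log_n; lia.
have [p sz_p] := refutation_size_upper pow_n lt_nm.
have [s min_s] := min_treelike_size_exists p.
exists s; split=> //.
have [[q sz_q] le_s] := min_s.
pose h := (2 ^ (k - 2))%N.
have def_h : n = (4 * h)%N by rewrite def_n -(expnD 2 2); congr expn; lia.
have h_gt0 : (0 < h)%N by rewrite expn_gt0.
have lower : (2 ^ h <= s)%N.
  have := refutation_size_lower pow_n log_gt0 q; rewrite sz_q.
  have -> : n./2 = (h + h)%N by lia.
  have : (2 ^ 1 <= 2 ^ h)%N by rewrite leq_exp2l.
  by rewrite expnD; nia.
have upper : (s <= 2 ^ (3 * n))%N := leq_trans (le_s p) (ltnW sz_p).
have -> : 4^-1 * n%:R = h%:R :> R.
  by rewrite def_h natrM mulKf // pnatr_eq0.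
rewrite -natrM !powR_mulrn ?ler0n // -!natrX !ler_nat.
by rewrite lower.
Qed.
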